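(* Let $\langle G,\phi\rangle$ be a finite $D$-geometry, i.e. a finite convex geometry without $D$-cycles. Then its basis $\Sigma_{FOE}$ is optimum.
   Context: All sets are finite. A closure system $\langle G,\phi\rangle$ is a set $G$ with a closure operator $\phi:2^G\to 2^G$; $X$ is closed if $\phi(X)=X$. It is a convex geometry if $\phi(\emptyset)=\emptyset$ and the anti-exchange axiom holds: for all $x\neq y$ in $G$ and all closed $X\subseteq G$, if $x\in\phi(X\cup\{y\})$ and $x\notin X$, then $y\notin\phi(X\cup\{x\})$. Convex geometries are standard: $\phi(\{i\})\setminus\{i\}$ is closed for every $i\in G$. Hence $a\ge_\phi b \iff b\in\phi(\{a\})$ defines a partial order on $G$. An implication $X\to Y$ is an ordered pair of nonempty disjoint subsets of $G$; it holds in $\langle G,\phi\rangle$ if $Y\subseteq\phi(X)$; it is binary if $|X|=1$, non-binary otherwise. A set $\Sigma$ of implications defines the closure system whose closed sets are the $Z\subseteq G$ such that for all $(X\to Y)\in\Sigma$, $X\subseteq Z$ implies $Y\subseteq Z$. A basis of $\langle G,\phi\rangle$ is a set of implications defining it. The size is $s(\Sigma)=\sum_{(X\to Y)\in\Sigma}(|X|+|Y|)$, and a basis is optimum if its size is minimum among all bases of the closure system. $D$-basis and $D$-cycles (for a standard closure system): the $D$-basis $\Sigma_D$ consists of all implications $a\to b$ with $b\in\phi(\{a\})\setminus\{a\}$, together with all implications $A\to b$ with $|A|\ge 2$, $b\in\phi(A)\setminus A$, such that for every $a\in A$ and every $C\subseteq\phi(\{a\})\setminus\{a\}$ the implication $(A\setminus\{a\})\cup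 C\to b$ does not hold, i.e. $b\notin\phi((A\setminus\{a\})\cup C)$. Write $bDa$ if $a\in A$ for some non-binary $(A\to b)\in\Sigma_D$. A $D$-cycle is a sequence $aDa_1D\cdots Da_kDa$. The system is without $D$-cycles if there is no such sequence. Critical sets: $Q\subseteq G$ is quasi-closed if it is not closed and $Q\cap X$ is closed for every closed $X$ with $Q\not\subseteq X$. A quasi-closed $C$ is critical if whenever $Q\subseteq C$ is quasi-closed and $\phi(Q)=\phi(C)$, then $Q=C$. Let $\mathcal C$ be the set of critical sets. Minimal order generators: given a set $S$ that is an order ideal (down-set) for $\ge_\phi$, choose an order ideal $C'\subseteq S$, minimal under inclusion, with $\phi(C')=\phi(S)$; the set of $\ge_\phi$-maximal elements of $C'$ is a minimal order generator of $\phi(S)$. For convex geometries it is unique, both for $S=C\in\mathcal C$ with $|C|>1$ (such $C$ is an order ideal) and for $S$ closed. The basis $\Sigma_{FOE}$ of a $D$-geometry consists of: (i) for each $x\in G$ with $\phi(\{x\})\ne\{x\}$, the implication $x\to Y$ where $Y$ is the unique minimal order generator of the closed set $\phi(\{x\})\setminus\{x\}$; (ii) for each $C\in\mathcal C$ with $|C|>1$, the implication $X_K\to Y_O$, where $X_K\subseteq C$ is the minimal order generator of $\phi(C)$, $Y_K$ is the set of $\ge_\phi$-maximal elements of $\phi(C)\setminus C$, and $Y_O$ is the set of those $y\in Y_K$ for which there is no $C'\in\mathcal C$ with $|C'|>1$, $y\in\phi(C')\setminus C'$ and $\phi(C')\subsetneq\phi(C)$. *)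

(* Defs.v *)
From mathcomp Require Import all_boot.

Set Implicit Arguments.
Unset Strict Implicit.
Unset Printing Implicit Defensive.

Section ClosureSystems.

Variable G : finType.

Definition implication : finType := ({set G} * {set G})%type.

Section Operator.

Variable phi : {set G} -> {set G}.

Definition closure_operator : Prop :=
  [/\ forall X : {set G}, X \subset phi X,
      forall X Y : {set G}, X \subset Y -> phi X \subset phi Y
    & forall X : {set G}, phi (phi X) = phi X].

Definition closed_set (X : {set G}) : bool := phi X == X.

Definition anti_exchange : Prop :=
  forall (x y : G) (X : {set G}), x != y -> closed_set X ->
    x \in phi (y |: X) -> x \notin X -> y \notin phi (x |: X).

Definition convex_geometry : Prop :=
  [/\ closure_operator, phi set0 = set0 & anti_exchange].

Definition ge_phi (a b : G) : bool := b \in phi [set a].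

Definition order_ideal (S : {set G}) : bool :=
  [forall a in S, forall b, ge_phi a b ==> (b \in S)].

Definition maximal_elements (S : {set G}) : {set G} :=
  [set m in S | [forall a in S, ge_phi a m ==> (a == m)]].

Definition holds (i : implication) : bool := i.2 \subset phi i.1.

Definition wf_implication (i : implication) : bool :=
  [&& i.1 != set0, i.2 != set0 & [disjoint i.1 & i.2]].

Definition is_basis (Sigma : {set implication}) : Prop :=
  (forall i, i \in Sigma -> wf_implication i) /\
  forall Z : {set G},
    closed_set Z <->
    (forall i, i \in Sigma -> i.1 \subset Z -> i.2 \subset Z).

Definition basis_size (Sigma : {set implication}) : nat :=
  \sum_(i in Sigma) (#|i.1| + #|i.2|).

Definition optimum (Sigma : {set implication}) : Prop :=
  is_basis Sigma /\
  forall Sigma' : {set implication},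
    is_basis Sigma' -> basis_size Sigma <= basis_size Sigma'.

Definition D_basis_binary : {set implication} :=
  [set i | [exists a, exists b,
     (b \in phi [set a] :\ a) && (i == ([set a], [set b]))]].

Definition D_basis_nonbinary : {set implication} :=
  [set i | [exists A : {set G}, exists b,
     [&& 1 < #|A|, b \in phi A :\: A,
         [forall a in A, forall C : {set G},
            (C \subset phi [set a] :\ a) ==>
            ~~ holds ((A :\ a) :|: C, [set b])]
       & i == (A, [set b])]]].

Definition D_basis : {set implication} := D_basis_binary :|: D_basis_nonbinary.

Definition relD (b a : G) : bool :=
  [exists A : {set G},
     [&& a \in A, #|A| != 1 & (A, [set b]) \in D_basis]].

Definition D_cycle (a a1 : G) (s : seq G) : bool :=
  cycle relD [:: a, a1 & s].

Definition without_D_cycles : Prop :=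
  forall (a a1 : G) (s : seq G), ~~ D_cycle a a1 s.

Definition D_geometry : Prop := convex_geometry /\ without_D_cycles.

Definition quasi_closed (Q : {set G}) : bool :=
  ~~ closed_set Q &&
  [forall X : {set G},
     (closed_set X && ~~ (Q \subset X)) ==> closed_set (Q :&: X)].

Definition critical (C : {set G}) : bool :=
  quasi_closed C &&
  [forall Q : {set G},
     [&& Q \subset C, quasi_closed Q & phi Q == phi C] ==> (Q == C)].

(* A relation rather than a function, so that no default value is needed: in a
   convex geometry, for S closed or S critical with 1 < #|S|, exactly one M
   satisfies it. *)
Definition min_order_generator (S M : {set G}) : bool :=
  [exists C : {set G},
     minset (fun I : {set G} =>
               [&& order_ideal I, I \subset S & phi I == phi S]) C
     && (M == maximal_elements C)].

Definition Y_K (C : {set G}) : {set G} := maximal_elements (phi C :\: C).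

Definition Y_O (C : {set G}) : {set G} :=
  [set y in Y_K C |
     ~~ [exists C' : {set G},
           [&& critical C', 1 < #|C'|, y \in phi C' :\: C'
             & phi C' \proper phi C]]].

Definition FOE_binary : {set implication} :=
  [set i | [exists x,
     [&& phi [set x] != [set x], i.1 == [set x]
       & min_order_generator (phi [set x] :\ x) i.2]]].

Definition FOE_nonbinary : {set implication} :=
  [set i | [exists C : {set G},
     [&& critical C, 1 < #|C|, min_order_generator C i.1 & i.2 == Y_O C]]].

Definition Sigma_FOE : {set implication} := FOE_binary :|: FOE_nonbinary.

End Operator.

End ClosureSystems.

(* Main.v *)
Require Import Defs.
From mathcomp Require Import all_boot.

(** Group the implications of a basis by the closure [phi i.1] of their premises
    and compare two bases one closed set [Z] at a time. In a convex geometry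
    every generating set of [Z] contains the set [extreme Z] of its extreme
    points, and [extreme Z] generates [Z] ([closure_extreme],
    [extreme_generators]). Hence [Z] has at most one critical set
    ([critical_least]), the minimal order generators are the sets of extreme
    points ([min_order_generatorE]), and [Sigma_FOE] has at most one implication
    for each [Z], whose premise is [extreme Z] ([FOE_closure_inj]).

    Lower bound. Let [y] be in the conclusion of the implication of [Sigma_FOE]
    for [Z]. Then a subset of [Z :\ y] whose closure contains [y] generates all
    of [Z], so in any basis [y] must be in the conclusion of some implication
    whose premise generates [Z]: otherwise [Z :\ y] would respect the basis
    without being closed ([necessary_conclusion], [FOE_necessary]). For a
    nonbinary implication this uses that any nontrivial derivation of [y] from
    [X] exhibits a critical set with closure inside [phi X] that misses [y]
    ([critical_conclusion]), which the definition of [Y_O] excludes below [Z].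
    So the implications of any basis for [Z] weigh at least
    [#|extreme Z| + #|Y|], where [Y] is the conclusion in [Sigma_FOE].

    [Sigma_FOE] is a basis. This is where the absence of D-cycles enters. By
    induction on [Z], a set respecting [Sigma_FOE] and containing [extreme Z]
    meets [Z] either in [Z] or in a quasi-closed set [V] that generates [Z]
    and contains the critical set [C]. If [C] is a singleton, the binary
    implications already force the first case ([FOE_respecting]). Otherwise [V]
    contains [Y_O C], which is impossible ([Y_O_generates]): call [u] in [Z :\: V] a sink if no subset of [Z] that
    generates less than [Z] has [u] in its closure, except through one of its
    elements above [u]. A point of [Z :\: V] that is not a sink is D-related to
    another point of [Z :\: V], so acyclicity gives a sink. The maximal points of
    [Z :\: V] are in [Y_K C] but not in [Y_O C], so they are not sinks. Take a
    maximal sink [u] and, among the points of [Z :\: V] strictly above it, a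
    point [x] that is D-related to none of the others. As [x] is not a sink, it
    has a D-cover [B] inside [Z] which generates less than [Z]; [u] is in the
    closure of [B], so [u] is below some [a] in [B]. The choice of [x] forces
    [a = u], and then [x] is D-related to [u], an element below [x],
    contradicting anti-exchange ([relD_not_below]). *)

Set Implicit Arguments.
Unset Strict Implicit.
Unset Printing Implicit Defensive.

(** * Unions of finite sets and acyclic relations *)

Lemma leq_card_bigcup (I T : finType) (P : pred I) (F : I -> {set T}) :
  #|\bigcup_(i | P i) F i| <= \sum_(i | P i) #|F i|.
Proof.
elim/big_rec2: _ => [|i n A _ le]; first by rewrite cards0.
by apply: leq_trans (leq_card_setU _ _) _; rewrite leq_add2l.
Qed.

(** Following [r] strictly shrinks the set of reachable points, since a path
    back would close a cycle; a point reaching the fewest is terminal. The second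
    hypothesis speaks of cycles of length at least 2 only, hence the first. *)
Lemma acyclic_terminal (T : finType) (r : rel T) (S : {set T}) :
    irreflexive r -> (forall a b s, ~~ cycle r [:: a, b & s]) -> S != set0 ->
  exists2 x, x \in S & forall y, y \in S -> ~~ r x y.
Proof.
move=> irr acyc /set0Pn[x0 Sx0].
pose m x := #|[set y | connect r x y]|.
case: (arg_minnP m Sx0) => x Sx xmin; exists x => // y Sy.
apply/negP => rxy; have := xmin y Sy; apply/negP; rewrite -ltnNge.
apply: proper_card; apply/properP; split.
  by apply/subsetP=> z; rewrite !inE; apply: connect_trans; apply: connect1.
exists x; rewrite ?inE ?connect0 //; apply/negP => /connectP[p].
elim/last_ind: p => [|p z _]; first by move=> _ /= xy; rewrite xy irr in rxy.
rewrite last_rcons => pth xz; subst z.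
by have := acyc x y p; rewrite /= rxy pth.
Qed.

(** * Closure operators and order ideals *)

Section ClosureOperator.

Variables (G : finType) (phi : {set G} -> {set G}).
Hypothesis phi_cl : closure_operator phi.

Implicit Types (Sigma : {set implication G}) (i j : implication G).
Implicit Types (X Y Z S A C Q U V W I : {set G}) (a b x y : G).

Lemma closure_extensive X : X \subset phi X.
Proof. by case: phi_cl. Qed.

Lemma closureS X Y : X \subset Y -> phi X \subset phi Y.
Proof. by case: phi_cl => _ h _; apply: h. Qed.

Lemma closureK X : phi (phi X) = phi X.
Proof. by case: phi_cl. Qed.

Lemma mem_closure X x : x \in X -> x \in phi X.
Proof. exact/subsetP/closure_extensive. Qed.

Lemma mem_closureS X Y x : X \subset Y -> x \in phi X -> x \in phi Y.
Proof. by move=> sXY; apply/subsetP/closureS. Qed.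

Lemma closed_closure X : closed_set phi (phi X).
Proof. by rewrite /closed_set closureK. Qed.

Lemma closure_min X Z : closed_set phi Z -> X \subset Z -> phi X \subset Z.
Proof. by move=> /eqP {2}<-; apply: closureS. Qed.

Lemma closedE Z : closed_set phi Z = (phi Z \subset Z).
Proof. by rewrite /closed_set eqEsubset closure_extensive andbT. Qed.

Lemma closure_sub_closure X Y : X \subset phi Y -> phi X \subset phi Y.
Proof. exact/closure_min/closed_closure. Qed.

Lemma closure_between X Y : X \subset Y -> Y \subset phi X -> phi Y = phi X.
Proof.
by move=> sXY sY; apply/eqP; rewrite eqEsubset closure_sub_closure ?closureS.
Qed.

Lemma ge_phi_refl a : ge_phi phi a a.
Proof. by apply/mem_closure/set11. Qed.

Lemma mem_closure1 a X b : a \in phi X -> b \in phi [set a] -> b \in phi X.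
Proof.
by move=> aX; apply/subsetP/closure_sub_closure; rewrite sub1set.
Qed.

Lemma ge_phi_trans a b c : ge_phi phi a b -> ge_phi phi b c -> ge_phi phi a c.
Proof. exact: mem_closure1. Qed.

Lemma order_idealP S :
  reflect (forall a b, a \in S -> ge_phi phi a b -> b \in S)
          (order_ideal phi S).
Proof.
apply: (iffP forall_inP) => [h a b aS ab | h a aS].
  by move/forallP/(_ b)/implyP: (h a aS); apply.
by apply/forallP=> b; apply/implyP; apply: h.
Qed.

Lemma closed_ideal Z : closed_set phi Z -> order_ideal phi Z.
Proof.
move=> cZ; apply/order_idealP=> a b aZ; apply: subsetP.
by apply: closure_min; rewrite ?sub1set.
Qed.

Definition down S : {set G} := \bigcup_(a in S) phi [set a].

Lemma downP S b : reflect (exists2 a, a \in S & ge_phi phi a b) (b \in down S).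
Proof. by apply: (iffP bigcupP). Qed.

Lemma down_ideal S : order_ideal phi (down S).
Proof.
apply/order_idealP=> a b /downP[c cS ca] ab.
by apply/downP; exists c => //; apply: ge_phi_trans ab.
Qed.

Lemma sub_down S : S \subset down S.
Proof.
by apply/subsetP=> a aS; apply/downP; exists a; rewrite ?ge_phi_refl.
Qed.

Lemma down_sub S I : order_ideal phi I -> S \subset I -> down S \subset I.
Proof.
move=> /order_idealP idI /subsetP sI; apply/subsetP=> b /downP[a aS ab].
by apply: idI ab; apply: sI.
Qed.

Lemma closure_down S : phi (down S) = phi S.
Proof.
apply: closure_between (sub_down S) _.
exact: down_sub (closed_ideal (closed_closure _)) (closure_extensive _).
Qed.

(** * Quasi-closed sets *)

Lemma quasi_closedI Q X :
  quasi_closed phi Q -> closed_set phi X -> ~~ (Q \subset X) ->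
  closed_set phi (Q :&: X).
Proof. by case/andP=> _ /forallP/(_ X)/implyP h cX QX; rewrite h ?cX. Qed.

Lemma quasi_closed_notclosed Q : quasi_closed phi Q -> ~~ closed_set phi Q.
Proof. by case/andP. Qed.

(** With [quasi_closed_closure], the characterization of quasi-closed sets used
    everywhere below: [Q] is stable under closing its subsets that generate less
    than [Q] does. *)
Lemma quasi_closed_intro Q :
  ~~ closed_set phi Q ->
  (forall U : {set G}, U \subset Q -> phi U != phi Q -> phi U \subset Q) ->
  quasi_closed phi Q.
Proof.
move=> nQ h; rewrite /quasi_closed nQ; apply/forallP=> X; apply/implyP.
case/andP=> cX nQX; rewrite closedE subsetI (closure_min cX) ?subsetIr // andbT.
apply: h; rewrite ?subsetIl //; apply: contra nQX => /eqP e.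
apply: subset_trans (closure_extensive Q) _.
by rewrite -e closure_min ?subsetIr.
Qed.

Lemma quasi_closed_closure Q U :
  quasi_closed phi Q -> U \subset Q -> phi U != phi Q -> phi U \subset Q.
Proof.
move=> qQ sU nU; have cI := quasi_closedI qQ (closed_closure U).
have nQU: ~~ (Q \subset phi U).
  by apply: contra nU => QU; rewrite eq_sym; apply/eqP/closure_between.
apply: subset_trans (subsetIl Q (phi U)).
by rewrite closure_min ?cI // subsetI sU closure_extensive.
Qed.

(** Explains the condition [1 < #|C|] on critical sets: if the closure of a
    quasi-closed set is generated by one of its elements, then its critical set
    is that singleton. *)
Lemma quasi_closed1 Q a :
  quasi_closed phi Q -> phi set0 = set0 -> phi Q = phi [set a] ->
  a \in Q -> quasi_closed phi [set a].
Proof.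
move=> qQ p0 e aQ; apply: quasi_closed_intro.
  apply: contra (quasi_closed_notclosed qQ) => /eqP ea.
  by rewrite closedE e ea sub1set.
move=> U; rewrite subset1 => /orP[/eqP-> | /eqP->]; first by rewrite eqxx.
by rewrite p0 sub0set.
Qed.

Lemma critical_quasi_closed C : critical phi C -> quasi_closed phi C.
Proof. by case/andP. Qed.

Lemma critical_below Q : quasi_closed phi Q ->
  exists C, [/\ critical phi C, C \subset Q & phi C = phi Q].
Proof.
move=> qQ; pose P C := quasi_closed phi C && (phi C == phi Q).
have [|C /minsetP[/andP[qC /eqP eC] minC] sC] := @minset_exists _ P Q.
  by rewrite /P qQ eqxx.
exists C; split=> //; rewrite /critical qC; apply/forallP=> R.
by apply/implyP=> /and3P[sR qR /eqP eR]; rewrite (minC R) // /P qR eR eC eqxx.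
Qed.

(** * Necessary conclusions *)

Lemma basis_holds Sigma i : is_basis phi Sigma -> i \in Sigma ->
  i.2 \subset phi i.1.
Proof.
case=> _ h iS; have [h1 _] := h (phi i.1).
exact: h1 (closed_closure _) i iS (closure_extensive _).
Qed.

(** [Z :\ y] is not closed, so it violates some implication of the basis; that
    implication can only fail by producing [y], and then its premise generates
    [Z]. *)
Lemma necessary_conclusion Sigma Z y :
    is_basis phi Sigma -> closed_set phi Z -> y \in phi (Z :\ y) ->
    (forall X, X \subset Z :\ y -> y \in phi X -> phi X = Z) ->
  exists2 j, j \in Sigma & (phi j.1 == Z) && (y \in j.2).
Proof.
move=> bS cZ yZ hy; have [_ hS] := bS.
case: (boolP [exists j in Sigma, (phi j.1 == Z) && (y \in j.2)]).
  by case/exists_inP=> j; exists j.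
move=> nex; have : closed_set phi (Z :\ y).
  apply/hS => j jS sj; have sj2 := basis_holds bS jS.
  rewrite subsetD1 (subset_trans sj2) /=; last first.
    by apply: closure_min => //; apply: subset_trans sj (subD1set _ _).
  apply: contra nex => yj; apply/exists_inP; exists j; rewrite ?yj ?andbT //.
  by apply/eqP/hy => //; apply: (subsetP sj2).
by move/eqP=> e; move: yZ; rewrite e !inE eqxx.
Qed.

(** A single premise of the class pays for [E]; the conclusions of the class
    together cover [Y]. *)
Lemma closure_class_size Sigma Z (E : {set G}) Y :
    Y != set0 -> (forall X, phi X = Z -> E \subset X) ->
    (forall y, y \in Y ->
       exists2 j, j \in Sigma & (phi j.1 == Z) && (y \in j.2)) ->
  #|E| + #|Y| <= \sum_(j in Sigma | phi j.1 == Z) (#|j.1| + #|j.2|).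
Proof.
move=> /set0Pn[y0 y0Y] hE hY; rewrite big_split; apply: leq_add.
  have [j jS /andP[/eqP ej _]] := hY y0 y0Y.
  rewrite (bigD1 j) /= ?jS ?ej ?eqxx //.
  by apply: leq_trans (leq_addr _ _); apply/subset_leq_card/hE.
apply: leq_trans (leq_card_bigcup _ _); apply: subset_leq_card.
apply/subsetP=> y /hY[j jS /andP[ej yj]].
by apply/bigcupP; exists j; rewrite ?jS.
Qed.

(** * Convex geometries and their extreme points *)

Hypothesis phi0 : phi set0 = set0.
Hypothesis phi_ae : anti_exchange phi.

Lemma closed0 : closed_set phi set0.
Proof. by rewrite /closed_set phi0. Qed.

Lemma ge_phi_anti a b : ge_phi phi a b -> ge_phi phi b a -> a = b.
Proof.
move=> ab ba; apply/eqP; apply: contraLR ba => nab; rewrite eq_sym in nab.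
have := phi_ae nab closed0; rewrite !setU0 inE => h.
exact: h.
Qed.

Lemma exists_maximal (P : pred G) a :
  P a -> exists2 m, P m & forall b, P b -> ge_phi phi b m -> b = m.
Proof.
move=> Pa; case: (arg_maxnP (fun z => #|phi [set z]|) Pa) => m Pm mmax.
exists m => // b Pb bm; apply: (ge_phi_anti bm).
have /eqP e : phi [set m] == phi [set b].
  rewrite eqEcard closure_sub_closure ?sub1set //; exact: mmax.
by rewrite /ge_phi e; apply/mem_closure/set11.
Qed.

Definition extreme Z : {set G} := [set e in Z | e \notin phi (Z :\ e)].

Lemma extreme_sub Z : extreme Z \subset Z.
Proof. by apply/subsetP=> e; rewrite inE => /andP[]. Qed.

(** A generating set avoiding [e] lies in [phi A :\ e], which would then generate
    the extreme point [e]. *)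
Lemma extreme_generators A : extreme (phi A) \subset A.
Proof.
apply/subsetP=> e; rewrite inE => /andP[eA]; apply: contraNT => neA.
by apply: mem_closureS eA; rewrite subsetD1 closure_extensive.
Qed.

Lemma closed_setD1_extreme Z e :
  closed_set phi Z -> e \in extreme Z -> closed_set phi (Z :\ e).
Proof.
move=> cZ; rewrite inE => /andP[_ ne]; rewrite closedE subsetD1 ne andbT.
exact: closure_min (subD1set _ _).
Qed.

(** The analogue of the Krein-Milman theorem. An element [a] of a minimal
    generating set [A] is extreme: otherwise let [Y] be a maximal closed set
    containing [A :\ a] and avoiding [a]. Some [z != a] of [Z] is outside [Y], so
    [a] is in [phi (z |: Y)] by maximality and [z] is in [phi (a |: Y) = Z],
    against anti-exchange. *)
Lemma closure_extreme Z : closed_set phi Z -> phi (extreme Z) = Z.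
Proof.
move=> cZ; pose P A := phi A == Z.
have [//|A /minsetP[/eqP eA minA] sA] := @minset_exists _ P Z.
suff sAe : A \subset extreme Z.
  apply/eqP; rewrite eqEsubset closure_min ?extreme_sub //=.
  by rewrite -{1}eA; apply: closureS.
apply/subsetP=> a aA; have aZ := subsetP sA a aA; rewrite inE aZ /=.
apply/negP=> aD.
pose R Y := [&& closed_set phi Y, a \notin Y & Y \subset Z].
have RX : R (phi (A :\ a)).
  rewrite /R closed_closure (closure_min cZ) ?andbT /=; last first.
    exact: subset_trans (subD1set _ _) sA.
  apply/negP=> aX; have e : phi A = phi (A :\ a).
    apply: closure_between (subD1set _ _) _.
    by rewrite -{1}(setD1K aA) subUset sub1set aX closure_extensive.
  have := minA (A :\ a); rewrite /P -e eA eqxx subD1set => /(_ isT isT) eD.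
  by move: aA; rewrite -eD !inE eqxx.
have [Y /maxsetP[/and3P[cY aY sY] maxY] sXY] := maxset_exists RX.
have /subsetPn[z zD zY] : ~~ (Z :\ a \subset Y).
  by apply: contra aY => /(closure_min cY)/subsetP; apply.
move: zD; rewrite !inE => /andP[nza zZ].
have aZY : a \in phi (z |: Y).
  apply: contraR zY => na; have <- : phi (z |: Y) = Y.
    apply: maxY; last first.
      exact: subset_trans (subsetUr _ _) (closure_extensive _).
    by rewrite /R closed_closure na closure_min // subUset sub1set zZ.
  by apply: mem_closure; rewrite setU11.
rewrite eq_sym in nza; have := phi_ae nza cY aZY aY; apply/negP; rewrite negbK.
have : z \in phi A by rewrite eA.
apply: mem_closureS; rewrite -{1}(setD1K aA) setUS //.
exact: subset_trans (closure_extensive _) sXY.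
Qed.

Lemma extreme_neq0 Z : closed_set phi Z -> Z != set0 -> extreme Z != set0.
Proof.
move=> cZ; apply: contra => /eqP e.
by rewrite -(closure_extreme cZ) e phi0.
Qed.

Lemma extreme1 x : extreme (phi [set x]) = [set x].
Proof.
have /extreme_neq0 : phi [set x] != set0.
  by apply/set0Pn; exists x; apply/mem_closure/set11.
move/(_ (closed_closure _)).
have := extreme_generators [set x].
by rewrite subset1 => /orP[/eqP|/eqP->] //; rewrite eqxx.
Qed.

Lemma closed_setD1_principal x : closed_set phi (phi [set x] :\ x).
Proof.
by apply: closed_setD1_extreme (closed_closure _) _; rewrite extreme1 set11.
Qed.

Lemma ge_extreme Z e a : e \in extreme Z -> a \in Z -> ge_phi phi a e -> a = e.
Proof.
rewrite inE => /andP[_]; move=> + aZ ae; apply: contraNeq => nae.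
by apply: (@mem_closure1 a) ae; apply: mem_closure; rewrite !inE nae.
Qed.

Lemma maximal_down_extreme Z :
  closed_set phi Z -> maximal_elements phi (down (extreme Z)) = extreme Z.
Proof.
move=> cZ.
have sDZ : down (extreme Z) \subset Z.
  exact: down_sub (closed_ideal cZ) (extreme_sub Z).
apply/setP=> m; rewrite inE.
apply/andP/idP => [[/downP[e eZ em] /forall_inP h]|mZ].
  by have := h e (subsetP (sub_down _) e eZ); rewrite em => /eqP <-.
split; first exact: subsetP (sub_down _) m mZ.
apply/forall_inP=> a aD; apply/implyP=> am; apply/eqP.
by apply: (ge_extreme mZ) am; apply: (subsetP sDZ).
Qed.

(** The order ideals generating [phi S] are those containing the extreme points,
    so the least one is the down-set of [extreme (phi S)], whose maximal elements
    are the extreme points. *)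
Lemma min_order_generatorE S M : order_ideal phi S ->
  min_order_generator phi S M = (M == extreme (phi S)).
Proof.
move=> idS; have cS := closed_closure S.
pose P I := [&& order_ideal phi I, I \subset S & phi I == phi S].
have minD I : P I -> down (extreme (phi S)) \subset I.
  case/and3P=> idI _ /eqP <-.
  by apply: down_sub idI _; apply: extreme_generators.
have PD : P (down (extreme (phi S))).
  rewrite /P down_ideal down_sub ?extreme_generators //=.
  by rewrite closure_down closure_extreme.
apply/existsP/idP => [[I /andP[/minsetP[PI mI]]] | /eqP->].
  by rewrite -(mI _ PD (minD _ PI)) maximal_down_extreme.
exists (down (extreme (phi S))); rewrite maximal_down_extreme // eqxx andbT.
apply/minsetP; split=> // I PI sI; apply/eqP.
by rewrite eqEsubset sI minD.
Qed.

(** * Critical sets of a convex geometry *)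

(** Both sets contain the extreme points of the common closure, and so does
    their intersection, which therefore generates the same closed set. This is
    what makes critical sets unique in a convex geometry. *)
Lemma quasi_closed_setI Q R : quasi_closed phi Q -> quasi_closed phi R ->
  phi Q = phi R -> quasi_closed phi (Q :&: R) /\ phi (Q :&: R) = phi Q.
Proof.
move=> qQ qR e.
have eI : phi (Q :&: R) = phi Q.
  apply/eqP; rewrite eqEsubset closureS ?subsetIl //=.
  rewrite -{1}(closure_extreme (closed_closure Q)) closureS // subsetI.
  by rewrite extreme_generators e extreme_generators.
split=> //; apply: quasi_closed_intro => [|U].
  apply: contra (quasi_closed_notclosed qQ); rewrite /closed_set eI => /eqP eQ.
  by rewrite eqEsubset closure_extensive andbT eQ subsetIl.
rewrite !subsetI eI => /andP[UQ UR] nU.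
by rewrite !quasi_closed_closure // -e.
Qed.

Lemma critical_least C Q : critical phi C -> quasi_closed phi Q ->
  phi Q = phi C -> C \subset Q.
Proof.
move=> /andP[qC /forallP minC] qQ e.
have [qI eI] := quasi_closed_setI qC qQ (esym e).
have /implyP := minC (C :&: Q); rewrite subsetIl qI eI eqxx => /(_ isT)/eqP <-.
exact: subsetIr.
Qed.

Lemma quasi_closed_ideal C Q : critical phi C -> 1 < #|C| ->
  quasi_closed phi Q -> phi Q = phi C -> order_ideal phi Q.
Proof.
move=> cC C1 qQ e; apply/order_idealP=> a b aQ.
apply: subsetP; apply: quasi_closed_closure => //; first by rewrite sub1set.
apply: contraL C1 => /eqP ea; rewrite -leqNgt -(cards1 a) subset_leq_card //.
by apply: critical_least; rewrite ?ea // (quasi_closed1 qQ).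
Qed.

Lemma critical_ideal C : critical phi C -> 1 < #|C| -> order_ideal phi C.
Proof.
by move=> cC C1; apply: (quasi_closed_ideal cC C1) => //; case/andP: cC.
Qed.

Lemma critical_not_above C y : critical phi C -> 1 < #|C| -> y \notin C ->
  forall a, a \in C -> ~~ ge_phi phi a y.
Proof.
move=> cC C1 yC a aC; apply: contra yC => ay.
exact: (order_idealP _ (critical_ideal cC C1)) ay.
Qed.

(** Call a closed set [Z] good if [y] is in the closure of [low Z], the points of
    [Z] that are not above [y]. Here [phi A] is good; inside it take a minimal
    good [Z]. By minimality [low Z] generates [Z], and a subset of [low Z] with
    smaller closure does not produce [y], hence produces only points of [low Z].
    So [low Z] is quasi-closed, and the critical set below it misses [y]. *)
Lemma critical_conclusion A y :
    y \in phi A -> (forall a, a \in A -> ~~ ge_phi phi a y) ->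
  exists C, [/\ critical phi C, 1 < #|C|, y \in phi C :\: C
                & phi C \subset phi A].
Proof.
move=> yA nA; pose low Z := [set z in Z | ~~ ge_phi phi z y].
pose P Z := closed_set phi Z && (y \in phi (low Z)).
have [|Z /minsetP[/andP[cZ yZ] minZ] sZ] := @minset_exists _ P (phi A).
  rewrite /P closed_closure; apply: mem_closureS yA.
  by apply/subsetP=> a aA; rewrite inE mem_closure ?nA.
have lowZ X : X \subset low Z -> y \in phi X -> phi X = Z.
  move=> sX yX; apply: minZ.
    rewrite /P closed_closure; apply: mem_closureS yX.
    apply/subsetP=> x xX; have := subsetP sX x xX.
    by rewrite !inE mem_closure // => /andP[].
  apply: closure_min => //; apply: subset_trans sX _.
  by apply/subsetP=> z; rewrite inE => /andP[].
have elow : phi (low Z) = Z by apply: lowZ.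
have ylow : y \notin low Z by rewrite inE ge_phi_refl andbF.
have qlow : quasi_closed phi (low Z).
  apply: quasi_closed_intro => [|U sU nU].
    by apply: contra ylow => /eqP <-.
  apply/subsetP=> u uU; rewrite inE -{1}elow (mem_closureS sU) //=.
  apply: contra nU => uy; rewrite elow; apply/eqP/lowZ => //.
  exact: mem_closure1 uU uy.
have [C [cC sC eC]] := critical_below qlow; exists C.
have yC : y \in phi C by rewrite eC.
have nyC : y \notin C by apply: contra ylow; apply: (subsetP sC).
split; rewrite ?inE ?yC ?nyC ?eC ?elow //.
rewrite ltnNge; apply/negP=> /card_le1_eqP C1.
have /set0Pn[c cC'] : C != set0.
  by apply/eqP=> C0; move: yC; rewrite C0 phi0 inE.
have := subsetP sC c cC'; rewrite inE /ge_phi => /andP[_]; apply/negP.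
rewrite negbK; apply: mem_closureS yC.
by apply/subsetP=> d dC; rewrite inE; apply/eqP/C1.
Qed.

(** * The D-relation *)

Lemma D_nonbinaryP A b : (A, [set b]) \in D_basis_nonbinary phi ->
  [/\ 1 < #|A|, b \in phi A, b \notin A &
      forall a C, a \in A -> C \subset phi [set a] :\ a ->
                  b \notin phi ((A :\ a) :|: C)].
Proof.
rewrite inE => /existsP[B /existsP[c /and4P[B1]]].
rewrite inE => /andP[cB cphi] /forall_inP h /eqP[eA /set1_inj eb].
subst B c; split=> // a C aA sC.
have /forallP/(_ C)/implyP/(_ sC) := h a aA.
by rewrite /holds /= sub1set.
Qed.

Lemma relD_intro A a b :
  (A, [set b]) \in D_basis_nonbinary phi -> a \in A -> relD phi b a.
Proof.
move=> hD aA; have [A1 _ _ _] := D_nonbinaryP hD.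
apply/existsP; exists A; rewrite aA inE hD orbT andbT /=.
by case: #|A| A1 => [|[]].
Qed.

Lemma relDE b a : relD phi b a ->
  exists2 A, (A, [set b]) \in D_basis_nonbinary phi & a \in A.
Proof.
case/existsP=> A /and3P[aA A1]; rewrite inE => /orP[|hD]; last by exists A.
rewrite inE => /existsP[c /existsP[d /andP[_ /eqP[eA _]]]].
by rewrite eA cards1 in A1.
Qed.

Lemma relD_irr : irreflexive (relD phi).
Proof.
move=> a; apply: negbTE; apply/negP => aDa; have [A hD aA] := relDE aDa.
by have [_ _] := D_nonbinaryP hD; rewrite aA.
Qed.

(** If [A -> b] is in the D-basis and [a] is in [A], then [b] is not in
    [phi (A :\ a)] but adding [a] produces it; by anti-exchange adding [b] does
    not produce [a]. *)
Lemma relD_not_below b a : relD phi b a -> ~~ ge_phi phi b a.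
Proof.
move=> bDa; have [A hD aA] := relDE bDa.
have [_ bA nbA minA] := D_nonbinaryP hD.
have nba : b != a by apply: contraNneq nbA => ->.
have bX : b \notin phi (A :\ a).
  by have := minA a set0 aA; rewrite setU0 sub0set; apply.
have bY : b \in phi (a |: phi (A :\ a)).
  apply: mem_closureS bA; rewrite -{1}(setD1K aA) setUS //.
  exact: closure_extensive.
apply: contra (phi_ae nba (closed_closure _) bY bX).
by apply: mem_closureS; rewrite subsetUl.
Qed.

(** Shrink the down-set of [A] to a minimal order ideal [I] producing [b] and
    take for [B] the maximal elements of [I]. Replacing some [a] in [B] by
    elements strictly below it stays inside the ideal [I :\ a], which does not
    produce [b] by minimality. *)
Lemma D_refinement A b :
    b \in phi A -> (forall a, a \in A -> ~~ ge_phi phi a b) ->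
  exists2 B, (B, [set b]) \in D_basis_nonbinary phi & B \subset phi A.
Proof.
move=> bA nA; pose P I := order_ideal phi I && (b \in phi I).
have [|I /minsetP[/andP[idI bI] minI] sI] := @minset_exists _ P (down A).
  by rewrite /P down_ideal closure_down.
have nbI : b \notin I.
  apply/negP=> /(subsetP sI)/downP[a aA]; apply/negP; exact: nA.
pose B := maximal_elements phi I.
have sB : B \subset I by apply/subsetP=> m; rewrite inE => /andP[].
have eB : phi B = phi I.
  apply/esym/(closure_between sB)/subsetP=> x xI.
  pose above z := (z \in I) && ge_phi phi z x.
  have xU : above x by rewrite /above xI ge_phi_refl.
  have [z /andP[zI zx] zmax] := exists_maximal xU.
  suff zB : z \in B by apply: (@mem_closure1 z) zx; apply: mem_closure.
  rewrite inE zI /=; apply/forall_inP=> a aI; apply/implyP=> az.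
  by apply/eqP/zmax => //; rewrite /above aI (ge_phi_trans az).
exists B; last first.
  apply: subset_trans sB (subset_trans sI _).
  by rewrite -closure_down closure_extensive.
rewrite inE; apply/existsP; exists B; apply/existsP; exists b.
have nbB : b \notin B by apply: contra nbI; apply: (subsetP sB).
rewrite eqxx andbT in_setD eB bI nbB /=; apply/andP; split.
  rewrite ltnNge; apply/negP=> /card_le1_eqP B1.
  have /set0Pn[c cB] : B != set0.
    by apply/eqP=> B0; move: bI; rewrite -eB B0 phi0 inE.
  case/negP: nbI; apply: (order_idealP _ idI c); first exact: (subsetP sB).
  rewrite /ge_phi; move: bI; rewrite -eB; apply: mem_closureS.
  by apply/subsetP=> d dB; rewrite inE; apply/eqP/B1.
apply/forall_inP=> a aB; apply/forallP=> C; apply/implyP=> sC.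
rewrite /holds /= sub1set; apply/negP=> bC.
have aI := subsetP sB a aB.
have idIa : order_ideal phi (I :\ a).
  apply/order_idealP=> c d; rewrite !inE => /andP[nca cI] cd.
  rewrite (order_idealP _ idI c d cI cd) andbT; apply: contraNneq nca => da.
  move: aB; rewrite inE => /andP[_ /forall_inP/(_ c cI)/implyP]; apply.
  by rewrite -da.
have := minI (I :\ a); rewrite subD1set /P idIa /= => e.
suff bIa : b \in phi (I :\ a) by move: aI; rewrite -(e bIa isT) !inE eqxx.
apply: mem_closureS bC; rewrite subUset setSD //=.
apply: subset_trans sC _; apply: setSD; apply/subsetP=> c.
exact: (order_idealP _ idI).
Qed.

(** * Conclusions of the nonbinary implications *)

Hypothesis phi_acyclic : without_D_cycles phi.

(** The argument by a maximal sink announced at the top, with [U] the set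
    [phi V :\: V] and a sink a point of [U] without covers. For [V = C] it shows
    that [Y_O C] is not empty. *)
Lemma Y_O_generates C V : critical phi C -> 1 < #|C| ->
  quasi_closed phi V -> phi V = phi C -> ~~ (Y_O phi C \subset V).
Proof.
move=> cC C1 qV eV; apply/negP=> sY.
have idV := quasi_closed_ideal cC C1 qV eV.
have sCV := critical_least cC qV eV.
set Z := phi V in eV; pose U := Z :\: V.
have U0 : U != set0.
  rewrite setD_eq0; apply: contra (quasi_closed_notclosed qV) => sZ.
  by rewrite closedE.
have upU u a : u \in U -> a \in Z -> ge_phi phi a u -> a \in U.
  rewrite !inE => /andP[nuV _] -> au; rewrite andbT.
  by apply: contra nuV => aV; apply: (order_idealP _ idV) au.
(* By [D_refinement], a cover of [x] yields a D-arrow from [x] inside [U]. *)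
pose covers A x := [&& A \subset Z, phi A != Z, x \in phi A
                     & [forall a in A, ~~ ge_phi phi a x]].
have coversD A x : x \in U -> covers A x ->
    exists2 B, (B, [set x]) \in D_basis_nonbinary phi & [/\ B \subset Z,
      phi B != Z & exists2 b, b \in U & relD phi x b].
  move=> xU /and4P[sA nA xA /forall_inP hA].
  have [B hB sB] := D_refinement xA hA; exists B => //.
  have sAZ : phi A \subset Z by apply: closure_sub_closure.
  have sBZ := subset_trans sB sAZ.
  have nB : phi B != Z.
    apply: contra nA => /eqP eB; rewrite eqEsubset sAZ -eB.
    exact: closure_sub_closure.
  split=> //; have /subsetPn[b bB nbV] : ~~ (B \subset V).
    apply/negP=> sBV; move: xU; rewrite !inE => /andP[/negP[]].
    apply: (subsetP (quasi_closed_closure qV sBV nB)).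
    by case: (D_nonbinaryP hB).
  exists b; last exact: relD_intro hB bB.
  by rewrite inE nbV (subsetP sBZ).
have coversM y : y \in U -> (forall a, a \in U -> ge_phi phi a y -> a = y) ->
    exists A, covers A y.
  move=> yU ymax.
  have [yV yZ] : y \notin V /\ y \in Z by apply/andP; rewrite -in_setD.
  have yC : y \notin C by apply: contra yV; apply: (subsetP sCV).
  have yK : y \in Y_K phi C.
    rewrite !inE yC -eV yZ /=; apply/forall_inP=> a; rewrite inE => /andP[_ aZ].
    by apply/implyP=> ay; apply/eqP/ymax => //; apply: upU ay.
  (* As [y] is not in [Y_O C], a smaller critical set derives it. *)
  have := contra (subsetP sY y) yV; rewrite inE yK negbK.
  case/existsP=> C' /and4P[cC' C'1]; rewrite inE => /andP[yC' ypC'] sC'.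
  exists C'; rewrite -eV in sC'; rewrite /covers ypC' (proper_neq sC').
  rewrite (subset_trans (closure_extensive C') (proper_sub sC')).
  by apply/forall_inP/critical_not_above.
pose sink u := (u \in U) && [forall A : {set G}, ~~ covers A u].
have [u0 u0S] : exists u, sink u.
  have [u uU uD] := acyclic_terminal relD_irr phi_acyclic U0.
  exists u; rewrite /sink uU; apply/forallP=> A; apply/negP=> cA.
  have [B _ [_ _ [b bU ub]]] := coversD A u uU cA.
  by case/negP: (uD b bU).
have [u /andP[uU /forallP uS] umax] := exists_maximal u0S.
(* The points of [U] strictly above the sink [u]. *)
pose T := [set x in U | ge_phi phi x u] :\ u.
have T0 : T != set0.
  apply/negP=> /eqP T0; have [] := coversM u uU => [a aU au|A cA].
    apply/eqP/negPn/negP=> nau; have := in_set0 a.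
    by rewrite -T0 !inE nau -in_setD aU au.
  by case/negP: (uS A).
have [x] := acyclic_terminal relD_irr phi_acyclic T0.
rewrite 2!inE inE => /and3P[nxu xU xu] xT.
have /existsP[A cA] : [exists A, covers A x].
  apply: contraNT nxu; rewrite negb_exists => nx.
  by apply/eqP/umax => //; rewrite /sink xU.
have [B hB [sB nB _]] := coversD A x xU cA.
have [_ xB _ _] := D_nonbinaryP hB.
(* [B] produces [x], hence [u], but does not cover the sink [u]. *)
have := uS B; rewrite /covers sB nB (mem_closure1 xB xu) => /forall_inPn[a aB].
rewrite negbK => au.
have xa := relD_intro hB aB.
have aU : a \in U by apply: upU uU _ au; apply: (subsetP sB).
case: (eqVneq a u) => [eau | nau].
  by have := relD_not_below xa; rewrite eau xu.
have aT : a \in T by rewrite !inE nau -in_setD aU.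
by have := xT a aT; rewrite xa.
Qed.

(** * The basis *)

Lemma FOE_binaryP i :
  reflect (exists2 x, phi [set x] != [set x]
                      & i = ([set x], extreme (phi [set x] :\ x)))
          (i \in FOE_binary phi).
Proof.
case: i => X Y; rewrite inE; apply: (iffP existsP) => [[x]|[x nx [-> ->]]].
  rewrite min_order_generatorE ?closed_ideal ?closed_setD1_principal //=.
  rewrite (eqP (closed_setD1_principal x)).
  by case/and3P=> nx /eqP -> /eqP ->; exists x.
exists x; rewrite nx eqxx /=.
rewrite min_order_generatorE ?closed_ideal ?closed_setD1_principal //.
by rewrite (eqP (closed_setD1_principal x)).
Qed.

Lemma FOE_nonbinaryP i :
  reflect (exists C, [/\ critical phi C, 1 < #|C|
                       & i = (extreme (phi C), Y_O phi C)])
          (i \in FOE_nonbinary phi).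
Proof.
case: i => X Y; rewrite inE.
apply: (iffP existsP) => [[C /and4P[cC C1 hM /eqP /= ->]]|[C [cC C1 [-> ->]]]].
  exists C; split=> //; move: hM.
  by rewrite min_order_generatorE ?critical_ideal //= => /eqP ->.
by exists C; rewrite cC C1 min_order_generatorE ?critical_ideal ?eqxx.
Qed.

Lemma Y_O_neq0 C : critical phi C -> 1 < #|C| -> Y_O phi C != set0.
Proof.
move=> cC C1; have qC := critical_quasi_closed cC.
apply: contra (Y_O_generates cC C1 qC erefl) => /eqP ->.
exact: sub0set.
Qed.

Lemma principal_setD1_neq0 x :
  phi [set x] != [set x] -> phi [set x] :\ x != set0.
Proof.
apply: contra; rewrite setD_eq0 => sx.
by rewrite eqEsubset sx closure_extensive.
Qed.

Lemma FOE_wf i : i \in Sigma_FOE phi -> wf_implication i.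
Proof.
rewrite inE => /orP[/FOE_binaryP[x nx ->]|/FOE_nonbinaryP[C [cC C1 ->]]].
  rewrite /wf_implication /= extreme_neq0 ?closed_setD1_principal //;
    last exact: principal_setD1_neq0.
  rewrite -cards_eq0 cards1 disjoints1 /=.
  apply/negP=> /(subsetP (extreme_sub _)).
  by rewrite !inE eqxx.
rewrite /wf_implication /= Y_O_neq0 // extreme_neq0 ?closed_closure //=.
  rewrite disjoints_subset; apply: subset_trans (extreme_generators C) _.
  by apply/subsetP=> c cC'; rewrite !inE cC'.
apply: contra (quasi_closed_notclosed (critical_quasi_closed cC)) => /eqP e.
by rewrite closedE e sub0set.
Qed.

Lemma FOE_holds i : i \in Sigma_FOE phi -> holds phi i.
Proof.
rewrite inE /holds.
case/orP=> [/FOE_binaryP[x nx ->]|/FOE_nonbinaryP[C [cC C1 ->]]] /=.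
  exact: subset_trans (extreme_sub _) (subD1set _ _).
rewrite closure_extreme ?closed_closure //; apply/subsetP=> y.
by rewrite !inE; case: (y \in phi C); rewrite ?andbF.
Qed.

(** Induction on [#|Z|]: the closed sets strictly inside [Z] being settled,
    [Z :&: W] is closed under them, so it is [Z] or quasi-closed. In the second
    case the implication of [Sigma_FOE] for [Z] applies; it is binary exactly when
    the critical set of [Z] is a singleton. *)
Lemma FOE_respecting W :
    (forall i, i \in Sigma_FOE phi -> i.1 \subset W -> i.2 \subset W) ->
  forall Z, closed_set phi Z -> extreme Z \subset W -> Z \subset W.
Proof.
move=> hW Z; move: {2}_.+1 (ltnSn #|Z|) => n; elim: n Z => // n IHn Z.
rewrite ltnS => leZn cZ sW; apply: contraTT isT => nZW.
pose V := Z :&: W.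
have eV : phi V = Z.
  apply/eqP; rewrite eqEsubset closure_min ?subsetIl //=.
  by rewrite -{1}(closure_extreme cZ) closureS // subsetI extreme_sub.
have IH Y :
    closed_set phi Y -> Y \proper Z -> extreme Y \subset W -> Y \subset W.
  by move=> cY /proper_card ltYZ; apply: IHn => //; apply: leq_trans ltYZ _.
have qV : quasi_closed phi V.
  apply: quasi_closed_intro => [|U].
    apply: contra nZW => /eqP; rewrite eV => e.
    by rewrite e subsetIr.
  rewrite eV !subsetI => /andP[UZ UW] nU.
  have sUZ : phi U \subset Z by apply: closure_min.
  rewrite sUZ IH ?closed_closure // ?properEneq ?nU //.
  exact: subset_trans (extreme_generators U) UW.
have [C [cC sCV eC]] := critical_below qV.
case: (ltnP 1 #|C|) => C1.
  case/negP: (Y_O_generates cC C1 qV (esym eC)).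
  have /hW /= : (extreme (phi C), Y_O phi C) \in Sigma_FOE phi.
    by rewrite inE; apply/orP; right; apply/FOE_nonbinaryP; exists C.
  rewrite eC eV sW subsetI => -> //; rewrite andbT.
  apply/subsetP=> y; rewrite !inE eC eV.
  by case: (y \in Z); rewrite ?andbF.
have /set0Pn[x xC] : C != set0.
  apply: contra (quasi_closed_notclosed (critical_quasi_closed cC)) => /eqP ->.
  exact: closed0.
have {}C1 : C = [set x].
  apply/eqP; rewrite eq_sym eqEcard sub1set xC cards1.
  exact: C1.
have eZ : phi [set x] = Z by rewrite -C1 eC.
have nx : phi [set x] != [set x].
  have := quasi_closed_notclosed (critical_quasi_closed cC).
  by rewrite C1.
have xV : x \in V by apply: (subsetP sCV).
have /hW /= : ([set x], extreme (phi [set x] :\ x)) \in Sigma_FOE phi.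
  by rewrite inE; apply/orP; left; apply/FOE_binaryP; exists x.
move: xV; rewrite inE sub1set => /andP[xZ xW] /(_ xW).
move/(IH _ (closed_setD1_principal x)).
rewrite eZ (properD1 xZ) => /(_ isT) sZx.
by move: nZW; rewrite -(setD1K xZ) subUset sub1set xW sZx.
Qed.

Lemma FOE_basis : is_basis phi (Sigma_FOE phi).
Proof.
split=> [|Z]; first exact: FOE_wf.
split=> [cZ i iS sZ | hZ].
  exact: subset_trans (FOE_holds iS) (closure_min cZ sZ).
rewrite closedE; apply: FOE_respecting hZ _ (closed_closure Z) _.
exact: extreme_generators.
Qed.

(** * The lower bound *)

(** The closure of a premise determines its extreme points and its critical set,
    hence the implication. A binary and a nonbinary implication cannot share it,
    since the critical set of [phi [set x]] is then [[set x]]. *)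
Lemma FOE_closure_inj :
  {in Sigma_FOE phi &, injective (fun i : implication G => phi i.1)}.
Proof.
have mixed x C : phi [set x] != [set x] -> critical phi C -> 1 < #|C| ->
    phi [set x] <> phi C.
  move=> nx cC C1 e.
  have : extreme (phi C) \subset C by apply: extreme_generators.
  rewrite -e extreme1 sub1set => xC.
  have q1 : quasi_closed phi [set x].
    exact: quasi_closed1 (critical_quasi_closed cC) phi0 (esym e) xC.
  have := subset_leq_card (critical_least cC q1 e).
  by rewrite cards1 leqNgt C1.
move=> i j; rewrite !in_setU.
case/orP=> [/FOE_binaryP[x nx ->]|/FOE_nonbinaryP[C [cC C1 ->]]];
case/orP=> [/FOE_binaryP[y ny ->]|/FOE_nonbinaryP[D [cD D1 ->]]] /=.
- move=> e; have /set1_inj -> // : [set x] = [set y].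
  by rewrite -extreme1 e extreme1.
- by rewrite closure_extreme ?closed_closure // => /(mixed x D nx cD D1).
- by rewrite closure_extreme ?closed_closure // => /esym /(mixed y C ny cC C1).
rewrite !closure_extreme ?closed_closure // => e.
have -> // : C = D.
apply/eqP; rewrite eqEsubset !critical_least //; exact: critical_quasi_closed.
Qed.

(** In the binary case, [y] is extreme in [phi [set x] :\ x], so a set avoiding
    [y] that produces it must contain [x]. In the nonbinary case, a set [X] inside
    [phi C :\ y] producing [y] has no element above [y] by the maximality of [y]
    outside the ideal [C], so [critical_conclusion] applies to it. *)
Lemma FOE_necessary Sigma i y : is_basis phi Sigma ->
    i \in Sigma_FOE phi -> y \in i.2 ->
  exists2 j, j \in Sigma & (phi j.1 == phi i.1) && (y \in j.2).
Proof.
move=> bS; rewrite inE.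
case/orP=> [/FOE_binaryP[x nx ->]|/FOE_nonbinaryP[C [cC C1 ->]]] /= yi.
  apply: (necessary_conclusion bS (closed_closure _)).
    have /andP[nyx yx] : (y != x) && (y \in phi [set x]).
      by rewrite -in_setD1; apply: (subsetP (extreme_sub _)).
    apply: mem_closureS yx; rewrite sub1set !inE eq_sym nyx.
    exact/mem_closure/set11.
  move=> X; rewrite subsetD1 => /andP[sX nyX] yX.
  apply/eqP; rewrite eqEsubset closure_min ?closed_closure //=.
  rewrite closure_sub_closure // sub1set; apply: contraTT yi => nx'.
  have nxX : x \notin X by apply: contra nx'; apply: mem_closure.
  rewrite inE negb_and negbK; apply/orP; right; apply: mem_closureS yX.
  by rewrite !subsetD1 sX nxX nyX.
rewrite closure_extreme ?closed_closure //.
move: yi; rewrite inE => /andP[yK nex].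
have [yC yZ ymax] : [/\ y \notin C, y \in phi C & forall a, a \in phi C :\: C ->
    ge_phi phi a y -> a = y].
  move: yK; rewrite 2!inE => /andP[/andP[-> ->] /forall_inP h].
  split=> // a aC ay.
  by apply/eqP; have := h a aC; rewrite ay.
apply: (necessary_conclusion bS (closed_closure _)).
  apply: mem_closureS yZ; rewrite subsetD1 yC.
  by rewrite closure_extensive.
move=> X; rewrite subsetD1 => /andP[sX nyX] yX; apply/eqP; apply: contraNT nex.
move=> nXC; have sXC : phi X \subset phi C by apply: closure_sub_closure.
have nA a : a \in X -> ~~ ge_phi phi a y.
  move=> aX; case: (boolP (a \in C)) => aC.
    exact: (critical_not_above cC C1 yC).
  apply: contra nyX => ay; rewrite -(ymax a _ ay) // inE aC.
  exact: (subsetP sX).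
have [C' [cC' C'1 yC' sC']] := critical_conclusion yX nA.
apply/existsP; exists C'; rewrite cC' C'1 yC' /=.
by apply: sub_proper_trans sC' _; rewrite properEneq nXC.
Qed.

Lemma FOE_optimum : optimum phi (Sigma_FOE phi).
Proof.
split=> [|Sigma bS]; first exact: FOE_basis.
have le_class i : i \in Sigma_FOE phi ->
    #|i.1| + #|i.2| <= \sum_(j in Sigma | phi j.1 == phi i.1) (#|j.1| + #|j.2|).
  move=> iS; have i1 : i.1 = extreme (phi i.1).
    move: iS; rewrite inE.
    case/orP=> [/FOE_binaryP[x _ ->]|/FOE_nonbinaryP[C [_ _ ->]]] /=.
      by rewrite extreme1.
    by rewrite closure_extreme ?closed_closure.
  apply: closure_class_size => [|X eX|y]; last exact: FOE_necessary.
    by case/and3P: (FOE_wf iS).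
  by rewrite i1 -eX extreme_generators.
rewrite /basis_size; apply: leq_trans (leq_sum _ _) _; first exact: le_class.
(* Each [j] in [Sigma] is charged by at most one implication [i]. *)
rewrite (exchange_big_dep (mem Sigma)) /=; last by move=> i j _ /andP[].
apply: leq_sum => j jS; rewrite sum_nat_const -[leqRHS]mul1n leq_mul2r.
apply/orP; right; apply/card_le1_eqP=> i i'.
move=> /and3P[iS _ /eqP ei] /and3P[i'S _ /eqP ei'].
by apply: FOE_closure_inj; rewrite // -ei.
Qed.

End ClosureOperator.

Theorem theorem23 (G : finType) (phi : {set G} -> {set G})
  (hD : D_geometry phi) : optimum phi (Sigma_FOE phi).
Proof. by case: hD => -[cl p0 ae] acyc; apply: FOE_optimum. Qed.
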